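(* Let $X$ be a separable Banach space and let $E$ be an infinite-dimensional Banach space. Then $\mathcal{CR}(X,E)\ge1$.
   Context: For metric spaces $(M_1,d_1)$, $(M_2,d_2)$ and an arbitrary (not necessarily continuous) map $\phi: M_1\to M_2$, define for $t\in(0,\infty)$ $$\kappa_\phi(t)=\inf_{d_1(x,y)\ge t} d_2(\phi(x),\phi(y)),\qquad \omega_\phi(t)=\sup_{d_1(x,y)\le t} d_2(\phi(x),\phi(y)),$$ with values in $[0,\infty]$, and $\kappa(\phi)=\sup_{t<\infty}\kappa_\phi(t)$, $\omega(\phi)=\inf_{t>0}\omega_\phi(t)$. The separation ratio of $\phi$ is $\mathcal{R}(\phi)=\kappa(\phi)/\omega(\phi)\in[0,\infty]$, with the conventions $\frac{a}{\infty}=\frac{0}{a}=0$ for all $a\in[0,\infty]$ and $\frac{a}{0}=\frac{\infty}{a}=\frac{\infty}{0}=\infty$ for all $a\in(0,\infty)$. The coarse embeddability ratio is $\mathcal{CR}(M_1,M_2)=\sup_\phi \mathcal{R}(\phi)$, the supremum over all maps $\phi:M_1\to M_2$. Banach spaces carry their norm metric. *)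

(* Defs.v *)
From HB Require Import structures.
From mathcomp Require Import all_boot all_order all_algebra.
From mathcomp Require Import all_classical all_reals all_analysis.
Import Order.TTheory GRing.Theory Num.Theory.
Import numFieldNormedType.Exports.

Set Implicit Arguments.
Unset Strict Implicit.
Unset Printing Implicit Defensive.

Local Open Scope classical_set_scope.
Local Open Scope ring_scope.

(* The library does not make a [normedModType] a [metricType]; this alias of
   [V] carries the metric of the norm, on top of the uniform structure of [V]. *)
Definition norm_metric (R : realType) (V : normedModType R) : Type := V.

Section norm_metric.
Variables (R : realType) (V : normedModType R).

HB.instance Definition _ := PseudoMetric.copy (norm_metric V) V.

Let dist (x y : norm_metric V) : R := `|(x : V) - (y : V)|.

Let dist_ge0 x y : 0 <= dist x y.
Proof. exact: normr_ge0. Qed.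

Let dist_positivity x y : dist x y = 0 -> x = y.
Proof. by move/eqP; rewrite /dist normr_eq0 subr_eq0 => /eqP. Qed.

Let ballEdist (x : norm_metric V) d : ball x d = [set y | dist x y < d].
Proof. by rewrite -[LHS]/(@ball R V x d) -ball_normE. Qed.

HB.instance Definition _ :=
  PseudoMetric_isMetric.Build R (norm_metric V)
    dist_ge0 dist_positivity ballEdist.

End norm_metric.

Section separation_ratio.
Local Open Scope ereal_scope.
Context {R : realType}.

(* Supremum in [0, +oo]: it differs from [ereal_sup] only in that the supremum
   of the empty set is 0 instead of -oo. *)
Definition nneg_sup (A : set (\bar R)) : \bar R := ereal_sup (0 |` A).

Context {M1 M2 : metricType R}.

(* The infimum of the empty set is +oo. *)
Definition kappa_at (phi : M1 -> M2) (t : R) : \bar R :=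
  ereal_inf [set (mdist (phi p.1) (phi p.2))%:E |
             p in [set p : M1 * M1 | (t <= mdist p.1 p.2)%R]].

Definition omega_at (phi : M1 -> M2) (t : R) : \bar R :=
  nneg_sup [set (mdist (phi p.1) (phi p.2))%:E |
            p in [set p : M1 * M1 | (mdist p.1 p.2 <= t)%R]].

Definition kappa (phi : M1 -> M2) : \bar R :=
  ereal_sup [set kappa_at phi t | t in [set t : R | (0 < t)%R]].

Definition omega (phi : M1 -> M2) : \bar R :=
  ereal_inf [set omega_at phi t | t in [set t : R | (0 < t)%R]].

(* On [0, +oo] the division of [\bar R] has the intended conventions: it is
   a * b^-1 with 0^-1 = +oo, +oo^-1 = 0 and 0 * +oo = 0, so that
   a / +oo = 0 / a = 0 for all a in [0, +oo] (including 0 / 0 = +oo / +oo = 0),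
   and a / 0 = +oo / a = +oo / 0 = +oo for all a in ]0, +oo[. *)
Definition separation_ratio (phi : M1 -> M2) : \bar R := kappa phi / omega phi.

End separation_ratio.

Definition coarse_embeddability_ratio (R : realType) (M1 M2 : metricType R) :
    \bar R :=
  nneg_sup [set separation_ratio phi | phi in [set: M1 -> M2]].

Definition separable (T : topologicalType) : Prop :=
  exists2 D : set T, countable D & dense D.

Definition finite_dimensional (R : realType) (V : lmodType R) : Prop :=
  exists (n : nat) (e : 'I_n -> V),
    forall v : V, exists c : 'I_n -> R, v = \sum_(i < n) c i *: e i.

(* Main.v *)
(* By Riesz's lemma the infinite-dimensional space E contains a sequence u with
   1 <= |u n - u m| <= 4 for n != m. Along a free ultrafilter U on nat the
   iterated limit L = lim_m lim_n |u n - u m| exists and is at least 1, and a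
   greedy choice of indices (Ramsey's argument) yields a subsequence w all of
   whose mutual distances lie within d of L. A countable dense subset of X gives
   f : X -> nat with fibres of diameter at most 2; then w \o f sends points at
   distance at least 2 to points at distance at least L - d, and its image has
   diameter at most L + d, so its separation ratio is at least
   (L - d) / (L + d), which tends to 1 with d. *)
Require Import Defs.
From mathcomp Require Import all_boot all_order all_algebra.
From mathcomp Require Import all_classical all_reals all_analysis.
From mathcomp Require Import lra.
Import Order.TTheory GRing.Theory Num.Theory.
Import numFieldNormedType.Exports.

Set Implicit Arguments.
Unset Strict Implicit.
Unset Printing Implicit Defensive.

Local Open Scope classical_set_scope.
Local Open Scope ring_scope.

(** Dependent choice in which each term sees the list of all earlier ones; it serves both the Riesz
    construction and the Ramsey selection. *)
Lemma greedy_sequence (T : Type) (P : seq T -> T -> Prop) :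
  (forall s, exists x, P s x) -> exists u : nat -> T, forall n, P (mkseq u n) (u n).
Proof.
move=> /choice[g Pg].
pose l n := iter n (fun s => rcons s (g s)) [::].
exists (g \o l) => n; suff -> : mkseq (g \o l) n = l n by exact: Pg.
by elim: n => //= n IH; rewrite mkseqS IH.
Qed.

(** * Finite-dimensional subspaces and Riesz's lemma *)

Section finite_span.
Variables (R : realType) (E : normedModType R).
Implicit Types (s : seq E) (x y : E).

(** Coefficients are indexed by [nat], so that a vector added in front of [s] only shifts them. *)
Definition span_set s : set E :=
  [set x | exists c : nat -> R, x = \sum_(i < size s) c i *: s`_i].

Lemma span_setZD s a x y :
  span_set s x -> span_set s y -> span_set s (a *: x + y).
Proof.
move=> [c ->] [d ->]; exists (fun i => a * c i + d i).
rewrite scaler_sumr -big_split; apply: eq_bigr => i _ /=.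
by rewrite scalerDl scalerA.
Qed.

Lemma span_set0 s : span_set s 0.
Proof.
by exists (fun=> 0); rewrite big1// => i _; rewrite scale0r.
Qed.

Lemma span_setZ s a x : span_set s x -> span_set s (a *: x).
Proof. by move=> sx; rewrite -[_ *: _]addr0; exact/span_setZD/span_set0. Qed.

Lemma span_setB s x y : span_set s x -> span_set s y -> span_set s (x - y).
Proof. by move=> sx sy; rewrite -scaleN1r addrC; exact: span_setZD. Qed.

Lemma span_set_consP v s x :
  span_set (v :: s) x <-> exists c, span_set s (x - c *: v).
Proof.
split=> [[c ->]|[c [d dE]]].
  exists (c 0%N); exists (c \o S).
  by rewrite big_ord_recl /= addrC addKr.
exists (fun i => if i is j.+1 then d j else c).
by rewrite big_ord_recl /= -dE addrC subrK.
Qed.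

Lemma mem_span_set s x : x \in s -> span_set s x.
Proof.
elim: s => // v s IH; rewrite inE => /predU1P[->|/IH sx]; apply/span_set_consP.
  by exists 1; rewrite scale1r subrr; exact: span_set0.
by exists 0; rewrite scale0r subr0.
Qed.

Lemma closed_norm_gap (F : set E) x : closed F -> ~ F x ->
  exists2 d : R, 0 < d & forall y, F y -> d <= `|x - y|.
Proof.
move=> Fcl Fx; have /nbhs_ballP[d d0 dF] : nbhs x (~` F).
  by apply: open_nbhs_nbhs; split => //; rewrite openC.
exists d => // y Fy; rewrite leNgt; apply/negP => xy.
by apply: (dF y) => //; rewrite -ball_normE.
Qed.

(* The coefficient along [v] is Lipschitz on the larger span, hence converges
   along any filter on it converging to a point of its closure. *)
Lemma closed_span_set s : closed (span_set s).
Proof.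
elim: s => [|v s IH].
  suff -> : span_set [::] = [set 0].
    exact: (accessible_closed_set1 (hausdorff_accessible (@norm_hausdorff _ E))).
  apply/seteqP; split => x /=; last by move=> ->; exact: span_set0.
  by move=> [c ->]; rewrite big_ord0.
have [sv|nsv] := pselect (span_set s v).
  suff -> : span_set (v :: s) = span_set s by [].
  apply/seteqP; split => x.
    move=> /span_set_consP[c]; move/(span_setZD c sv).
    by rewrite addrC subrK.
  by move=> sx; apply/span_set_consP; exists 0; rewrite scale0r subr0.
have [d d0 dv] := closed_norm_gap IH nsv.
(* For [c.1 != c.2], the vector [v - (x - y) / (c.1 - c.2)] lies in [span_set s], hence at distance
   at least [d] from [v]. *)
have lip c x y : span_set s (x - c.1 *: v) -> span_set s (y - c.2 *: v) ->
    `|c.1 - c.2| * d <= `|x - y|.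
  move=> sx sy; have [->|c12] := eqVneq c.1 c.2.
    by rewrite subrr normr0 mul0r.
  have b0 : c.1 - c.2 != 0 by rewrite subr_eq0.
  have := dv _ (span_setZ (- (c.1 - c.2)^-1) (span_setB sx sy)).
  rewrite -(ler_pM2l (_ : 0 < `|c.1 - c.2|)) ?normr_gt0// -normrZ.
  rewrite scalerBr scaleNr scalerN opprK scalerKV// scalerBl opprB addrACA.
  by rewrite (addrC (c.1 *: v)) subrK addKr.
have /choice[c cP] x : exists b : R,
    span_set (v :: s) x -> span_set s (x - b *: v).
  have [/span_set_consP[b sb]|?] := pselect (span_set (v :: s) x); last by exists 0.
  by exists b.
move=> x xcl; pose G := within (span_set (v :: s)) (nbhs x).
have GF : ProperFilter G by exact: within_nbhs_proper.
have /cauchy_cvgP/cvg_ex[b cb] : cauchy (c @ G).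
  apply/cauchyP => e e0 /=.
  (* Two points this close to [x] are within [e * d] of each other, so [lip] puts their coefficients
     within [e]. *)
  have ed0 : 0 < e * d / 2 by rewrite divr_gt0// mulr_gt0.
  have [y [sy xy]] := xcl _ (nbhsx_ballx x _ ed0).
  exists (c y).
  rewrite /nbhs/= /G /within /=; near=> z => sz.
  rewrite -ball_normE/= -(ltr_pM2r d0).
  apply: le_lt_trans (lip (c y, c z) _ _ (cP _ sy) (cP _ sz)) _.
  have -> : y - z = - (x - y) + (x - z) by rewrite opprB addrA subrK.
  rewrite (le_lt_trans (ler_normD _ _))// normrN.
  have xy' : `|x - y| < e * d / 2 by move: xy; rewrite -ball_normE.
  have xz' : `|x - z| < e * d / 2.
    by near: z; move: (nbhsx_ballx x _ ed0); rewrite -ball_normE.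
  by lra.
apply/span_set_consP; exists b.
apply: (@closed_cvg _ _ G _ (fun y => y - c y *: v) _ IH).
  by rewrite /prop_near1 /nbhs/= /G/within/=; near=> y => sy; exact: cP.
apply: cvgB; last exact: cvgZr_tmp.
exact: cvg_within.
Unshelve. all: by end_near.
Qed.

(** Take [v] outside the span and [y] in it with [v - y] shorter than twice the distance from [v] to
    the span, then divide [v - y] by that distance. *)
Lemma riesz_span_set s : ~ finite_dimensional E ->
  exists u : E, `|u| <= 2 /\ forall x, span_set s x -> 1 <= `|u - x|.
Proof.
move=> dimE; have [v nsv] : exists v, ~ span_set s v.
  apply/existsNP => sE; apply: dimE.
  exists (size s), (fun i => s`_i) => v.
  by have [c ->] := sE v; exists (fun i => c i).
have [d d0 dv] := closed_norm_gap (@closed_span_set s) nsv.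
pose A := [set `|v - x| | x in span_set s].
have Ainf : has_inf A.
  split; first by exists `|v - 0|, 0 => //; exact: span_set0.
  by exists d => _ [x sx <-]; exact: dv.
have i0 : 0 < inf A.
  apply: lt_le_trans d0 _; apply: lb_le_inf; first exact: Ainf.1.
  by move=> _ [x sx <-]; exact: dv.
have [_ [y sy <-] yi] := inf_adherent i0 Ainf.
exists ((inf A)^-1 *: (v - y)); split.
  rewrite normrZ gtr0_norm ?invr_gt0// ler_pdivrMl//.
  by rewrite mulr_natr mulr2n ltW.
move=> x sx; rewrite -[x](scalerK (lt0r_neq0 i0)) -scalerBr normrZ.
rewrite gtr0_norm ?invr_gt0// ler_pdivlMl// mulr1 -addrA -opprD.
apply: ge_inf; first exact: Ainf.2.
exists (y + inf A *: x) => //.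
by rewrite addrC; exact: span_setZD.
Qed.

Lemma bounded_separated_sequence : ~ finite_dimensional E ->
  exists u : nat -> E, forall m n, (m < n)%N -> 1 <= `|u n - u m| <= 4.
Proof.
move=> dimE; have [u uP] := greedy_sequence (fun s => riesz_span_set s dimE).
exists u => m n mn; have [u2 u1] := uP n.
apply/andP; split.
  by apply/u1/mem_span_set/mapP; exists m => //; rewrite mem_iota.
have := ler_normB (u n) (u m); have [um2 _] := uP m; lra.
Qed.

End finite_span.

(** * Limits along an ultrafilter and Ramsey's argument *)

Section ultrafilter_ramsey.
Variables (R : realType) (U : set_system nat).
Hypothesis U_ultra : UltraFilter U.

(** Compactness of [[a, b]] gives the image of [U] a cluster point, and an ultrafilter, containing
    each set or its complement, converges to it. *)
Lemma ultra_limit (f : nat -> R) (a b : R) : (\forall n \near U, a <= f n <= b) ->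
  exists2 L, a <= L <= b & forall e, 0 < e -> \forall n \near U, `|f n - L| < e.
Proof.
move=> fab.
have [L [abL fL]] := @segment_compact R a b (f @ U) _ fab.
exists L; first by move: abL; rewrite /= in_itv.
move=> e e0; have [//|Un] := in_ultra_setVsetC [set n | `|f n - L| < e] U_ultra.
have [r [/= nr]] := fL [set r | ~ (`|r - L| < e)] _ Un (nbhsx_ballx L _ e0).
by rewrite -ball_normE/= distrC.
Qed.

End ultrafilter_ramsey.

Lemma almost_constant_subsequence (R : realType) (d : nat -> nat -> R) (a b : R) :
  (forall m n, (m < n)%N -> a <= d m n <= b) -> forall e, 0 < e ->
  exists2 L, a <= L & exists s : nat -> nat,
    forall i j, (i < j)%N -> `|d (s i) (s j) - L| < e.
Proof.
move=> dab e e0.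
(* Refining the filter of cofinal segments makes [m < n] hold for [U]-almost every [n]. *)
have [U [U_ultra U_oo]] := ultraFilterLemma eventually_filter.
have /choice[l lP] m : exists L, a <= L <= b /\
    forall e, 0 < e -> \forall n \near U, `|d m n - L| < e.
  have [|L abL dL] := @ultra_limit R U U_ultra (d m) a b; last by exists L.
  by apply: U_oo; exists m.+1 => // n /= /dab.
have [|L /andP[aL _] lL] := @ultra_limit R U U_ultra l a b.
  by apply: filterE => m; have [] := lP m.
exists L => //.
have e2 : 0 < e / 2 by rewrite divr_gt0.
(* A new index must have its row limit near [L] and lie near the row limits of all earlier indices:
   finitely many conditions, each true [U]-almost everywhere. *)
have [t|s sP] := @greedy_sequence nat (fun t n =>
    `|l n - L| < e / 2 /\ forall m, m \in t -> `|d m n - l m| < e / 2).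
  suff : \forall n \near U,
      `|l n - L| < e / 2 /\ forall m, m \in t -> `|d m n - l m| < e / 2.
    exact: filter_ex.
  apply: filterI; first exact: lL.
  elim: t => [|m t IH]; first exact: filterE.
  have [_ /(_ _ e2) dm] := lP m.
  apply: filterS (filterI dm IH) => n [dmn tn] k.
  by rewrite inE => /predU1P[->|/tn].
exists s => i j ij; have [li _] := sP i; have [_ dj] := sP j.
have /dj dij : s i \in mkseq s j by apply/mapP; exists i => //; rewrite mem_iota.
rewrite -(subrK (l (s i)) (d _ _)) -addrA (le_lt_trans (ler_normD _ _))//.
lra.
Qed.

Lemma almost_equilateral_sequence (R : realType) (E : normedModType R) (e : R) :
  ~ finite_dimensional E -> 0 < e ->
  exists2 L : R, 1 <= L & exists w : nat -> E,
    forall i j, i != j -> `| `|w i - w j| - L| < e.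
Proof.
move=> dimE e0; have [u uP] := bounded_separated_sequence dimE.
have [L L1 [s sP]] := @almost_constant_subsequence R _ _ _ uP _ e0.
exists L => //; exists (u \o s) => i j.
by rewrite neq_ltn => /orP[] /sP//; rewrite (distrC (u (s j))).
Qed.

Lemma separable_bounded_fibres (R : realType) (X : normedModType R) :
  separable X -> exists f : X -> nat, forall x y, f x = f y -> `|x - y| < 2.
Proof.
move=> [D /countable_injP[g ginj] Dd].
have /choice[p pP] (x : X) : exists y, D y /\ `|x - y| < 1.
  have [||y [xy Dy]] := Dd (ball x 1).
  - by exists x; exact: ballxx.
  - exact: ball_open.
  by exists y; split => //; move: xy; rewrite -ball_normE.
exists (g \o p) => x y /= gxy; have [Dx xp] := pP x; have [Dy yp] := pP y.
have pxy : p x = p y by apply: ginj; rewrite ?inE.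
rewrite -(subrK (p x) x) -addrA (le_lt_trans (ler_normD _ _))//.
rewrite {2}pxy [X in _ + X]distrC; lra.
Qed.

(** A single scale [t] suffices, since [kappa] is a supremum and [omega] an infimum over scales. *)
Lemma separation_ratio_ge (R : realType) (M1 M2 : metricType R) (phi : M1 -> M2)
    (t a b : R) : 0 < t -> 0 < a -> a <= b ->
  (forall x y, t <= mdist x y -> a <= mdist (phi x) (phi y)) ->
  (forall x y, mdist (phi x) (phi y) <= b) ->
  ((a / b)%:E <= separation_ratio phi)%E.
Proof.
move=> t0 a0 ab ka ob.
have ka' : (a%:E <= kappa phi)%E.
  apply: (@le_trans _ _ (kappa_at phi t)).
    by apply: le_ereal_inf_tmp => _ [[x y] /= /ka xy <-]; rewrite lee_fin.
  by apply: ereal_sup_ubound; exists t.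
have ob' : (omega phi <= b%:E)%E.
  apply: (@le_trans _ _ (omega_at phi t)).
    by apply: ereal_inf_lbound; exists t.
  apply: ge_ereal_sup => _ [->|[[x y] _ <-]]; rewrite lee_fin//.
  by rewrite ltW// (lt_le_trans a0).
have o0 : (0 <= omega phi)%E.
  apply: le_ereal_inf_tmp => _ [r _ <-].
  by apply: ereal_sup_ubound; left.
have b0 : 0 < b by exact: lt_le_trans ab.
rewrite /separation_ratio EFinM; apply: lee_pmul => //.
- by rewrite lee_fin ltW.
- by rewrite lee_fin invr_ge0 ltW.
case: (omega phi) o0 ob' => [r| |]//; rewrite !lee_fin => r0 rb.
(* [omega phi] may be 0, and its inverse is then [+oo]. *)
rewrite /inve; case: eqP => [_|/eqP rn0]; first exact: leey.
by rewrite lee_fin lef_pV2// posrE lt_neqAle eq_sym rn0.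
Qed.

Theorem proposition2p7 (R : realType) (X E : completeNormedModType R)
    (X_separable : separable X) (E_infinite_dim : ~ finite_dimensional E) :
  (1 <= coarse_embeddability_ratio (norm_metric X) (norm_metric E))%E.
Proof.
apply/lee_subgt0Pr => e e0.
have [f fP] := separable_bounded_fibres X_separable.
(* As [1 <= L], the bound [1 / 2] keeps [L - d] positive, and [e / 2] gives [(L - d) / (L + d) = 1 -
   2 d / (L + d) >= 1 - e]. *)
pose d : R := Num.min (e / 2) (1 / 2).
have d0 : 0 < d by rewrite /d lt_min !divr_gt0.
have de : d <= e / 2 by rewrite /d ge_min lexx.
have d1 : d <= 1 / 2 by rewrite /d ge_min lexx orbT.
have [L L1 [w wP]] := almost_equilateral_sequence E_infinite_dim d0.
pose phi : norm_metric X -> norm_metric E := w \o f.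
have ratio : (((L - d) / (L + d))%:E <= separation_ratio phi)%E.
  apply: (@separation_ratio_ge _ _ _ phi 2) => //; [lra|lra| |].
  - move=> x y xy; have /wP : f x != f y.
      by apply/eqP => /fP; rewrite ltNge => /negP; apply.
    by rewrite ltr_distl => /andP[/ltW].
  - move=> x y; have [fxy|/wP] := eqVneq (f x) (f y).
      by rewrite /phi/= fxy mdistxx; lra.
    by rewrite ltr_distl => /andP[_ /ltW].
apply: (@le_trans _ _ (separation_ratio phi)); last first.
  by apply: ereal_sup_ubound; right; exists phi.
apply: le_trans ratio; rewrite -EFinB lee_fin ler_pdivlMr; last lra.
nra.
Qed.
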